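(* Let $X$ be a Banach space and $\{C_\omega\}_{\omega\in\Omega}$ an indexed collection of closed cones in $X$. Let $Z$ be either of the spaces $\mathbf{c}(\Omega,X)$ or $\ell^\infty(\Omega,X)$. Then the following are equivalent: (1) For every $\xi\in Z$, the intersection $\bigcap_{\omega\in\Omega}(\xi_\omega+C_\omega)$ is non-empty. (2) There exists an $\alpha>0$ such that, for every $\xi\in Z$, there exists some $y\in\bigcap_{\omega\in\Omega}(\xi_\omega+C_\omega)$ with $\|y\|\le\alpha\|\xi\|_\infty$. (3) There exists an $\alpha>0$ and a continuous positively homogeneous map $\upsilon:Z\to X$ such that, for every $\xi\in Z$, we have $\upsilon(\xi)\in\bigcap_{\omega\in\Omega}(\xi_\omega+C_\omega)$ and $\|\upsilon(\xi)\|\le\alpha\|\xi\|_\infty$.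
   Context: All vector spaces are over the reals. A cone in a vector space $V$ is a non-empty subset $C\subseteq V$ with $C+C\subseteq C$ and $\lambda C\subseteq C$ for all $\lambda\ge 0$ (it need not be proper). $\Omega$ is an arbitrary index set. $\ell^\infty(\Omega,X)$ is the Banach space of bounded functions $\xi:\Omega\to X$, $\omega\mapsto\xi_\omega$, with norm $\|\xi\|_\infty=\sup_{\omega\in\Omega}\|\xi_\omega\|$. $\mathbf{c}(\Omega,X)$ is the closed subspace of $\ell^\infty(\Omega,X)$ (with the same norm) of all $\xi$ for which there exists $x\in X$ such that, for every $\varepsilon>0$, the set $\{\omega\in\Omega : \|\xi_\omega-x\|\ge\varepsilon\}$ is finite. A map $f$ between vector spaces is positively homogeneous if $f(\lambda v)=\lambda f(v)$ for all $v$ and all $\lambda\ge 0$. *)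

(* Defs.v *)
From HB Require Import structures.
From mathcomp Require Import all_boot all_order all_algebra.
From mathcomp Require Import all_classical all_reals all_analysis.

Set Implicit Arguments.
Unset Strict Implicit.
Unset Printing Implicit Defensive.
Set Warnings "-redundant-canonical-projection".

Import Order.TTheory GRing.Theory Num.Theory.
Import numFieldNormedType.Exports.

Local Open Scope classical_set_scope.
Local Open Scope ring_scope.

Section Linfty.
Context {R : realType} (Omega : Type) (X : normedModType R).

Definition linfty_pred : {pred Omega -> X} :=
  mem [set f : Omega -> X | bounded_fun f].

Lemma linfty_predP (f : Omega -> X) :
  f \in linfty_pred <-> exists M : R, forall w, `|f w| <= M.
Proof.
rewrite /linfty_pred inE /=; split.
- move=> [M [_ h]]; exists (M + 1) => w.
  by apply: (h (M + 1)) => //; rewrite ltrDl.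
- move=> [M h]; exists M; split; first exact: num_real.
  by move=> N MN w _ /=; exact: le_trans (h w) (ltW MN).
Qed.

Lemma linfty_submod_closed : submod_closed linfty_pred.
Proof.
split; first by apply/linfty_predP; exists 0 => w /=; rewrite normr0.
move=> a f g /linfty_predP[M hM] /linfty_predP[N hN].
apply/linfty_predP; exists (`|a| * M + N) => w /=.
rewrite (le_trans (ler_normD _ _)) // lerD // normrZ.
by rewrite ler_wpM2l.
Qed.

HB.instance Definition _ :=
  GRing.isSubmodClosed.Build R (Omega -> X) linfty_pred linfty_submod_closed.

(* The structure instances below make this the space with pointwise operations
   and the supremum norm; its topology is the one induced by that norm. *)
Record linfty := Linfty {
  linfty_fun :> Omega -> X ;
  linfty_funP : linfty_fun \in linfty_pred }.

HB.instance Definition _ := [isSub for linfty_fun].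
HB.instance Definition _ := [Choice of linfty by <:].
HB.instance Definition _ := [SubChoice_isSubLmodule of linfty by <:].

(* For empty Omega this is the right value 0, since sup set0 = 0. *)
Definition linfty_norm (xi : linfty) : R := sup [set `|xi w| | w in setT].

Lemma linfty_norm_ub (xi : linfty) w : `|xi w| <= linfty_norm xi.
Proof.
have /linfty_predP[M hM] := linfty_funP xi.
by apply: ub_le_sup; [exists M => _ [v _ <-]; exact: hM | exists w].
Qed.

Lemma linfty_norm_ge0 (xi : linfty) : 0 <= linfty_norm xi.
Proof.
have [E|/set0P[_ [w _ _]]] := eqVneq [set `|xi w| | w in setT] set0.
  by rewrite /linfty_norm E sup0.
by apply: le_trans (linfty_norm_ub xi w).
Qed.

Lemma linfty_norm_le (xi : linfty) (M : R) :
  0 <= M -> (forall w, `|xi w| <= M) -> linfty_norm xi <= M.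
Proof.
move=> M0 hM; rewrite /linfty_norm.
have [E|/set0P ne] := eqVneq [set `|xi w| | w in setT] set0.
  by rewrite E sup0.
by apply: ge_sup => // _ [w _ <-]; exact: hM.
Qed.

Lemma linfty_ler_normD (x y : linfty) :
  linfty_norm (x + y) <= linfty_norm x + linfty_norm y.
Proof.
apply: linfty_norm_le; first by rewrite addr_ge0 // linfty_norm_ge0.
move=> w; apply: (le_trans (ler_normD (x w) (y w))).
by rewrite lerD // linfty_norm_ub.
Qed.

Lemma linfty_normZ (l : R) (x : linfty) :
  linfty_norm (l *: x) = `|l| * linfty_norm x.
Proof.
have le (a : R) (z : linfty) : linfty_norm (a *: z) <= `|a| * linfty_norm z.
  apply: linfty_norm_le; first by rewrite mulr_ge0 // linfty_norm_ge0.
  move=> w; rewrite -[_ w]/(a *: z w) normrZ ler_wpM2l //.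
  exact: linfty_norm_ub.
apply/eqP; rewrite eq_le le /=.
have [->|l0] := eqVneq l 0; first by rewrite normr0 mul0r linfty_norm_ge0.
have := le l^-1 (l *: x).
by rewrite scalerA mulVf // scale1r normfV ler_pdivlMl // normr_gt0.
Qed.

Lemma linfty_norm0_eq0 (x : linfty) : linfty_norm x = 0 -> x = 0.
Proof.
move=> x0; apply/val_inj/funext => w /=; apply/eqP.
by rewrite -normr_le0 -x0 linfty_norm_ub.
Qed.

HB.instance Definition _ := Lmodule_isNormed.Build R linfty
  linfty_ler_normD linfty_normZ linfty_norm0_eq0.

Lemma linfty_normE (xi : linfty) : `|xi| = sup [set `|xi w| | w in setT].
Proof. by []. Qed.

End Linfty.

Section Cspace.
Context {R : realType} (Omega : Type) (X : normedModType R).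

Definition cspace_pred : {pred linfty Omega X} :=
  mem [set xi : linfty Omega X | exists x : X,
    forall e : R, 0 < e -> finite_set [set w | e <= `|xi w - x|]].

Lemma cspace_submod_closed : submod_closed cspace_pred.
Proof.
split.
  rewrite inE /=; exists 0 => e e0.
  rewrite (_ : [set _ | _] = set0) //; apply/seteqP; split => // w /=.
  by rewrite subr0 normr0 leNgt e0.
move=> a f g; rewrite !inE => -[x hx] [y hy]; exists (a *: x + y) => e e0.
have d0 : 0 < e / 2 / (`|a| + 1) by rewrite !divr_gt0 // ltr_wpDl.
apply: (@sub_finite_set _ _
  ([set w | e / 2 / (`|a| + 1) <= `|f w - x|] `|`
   [set w | e / 2 <= `|g w - y|])); last first.
  by rewrite finite_setU; split; [exact: hx | apply: hy; rewrite divr_gt0].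
move=> w /= h0.
have {h0} h : e <= `|(a *: f w + g w) - (a *: x + y)| := h0.
apply/orP; apply: contraLR h; rewrite negb_or -!ltNge => /andP[h1 h2].
rewrite opprD addrACA -scalerBr (le_lt_trans (ler_normD _ _)) //.
rewrite normrZ [ltRHS]splitr ler_ltD //.
move: h1; rewrite ltr_pdivlMr ?ltr_wpDl // => /ltW; apply: le_trans.
by rewrite mulrC ler_wpM2l // lerDl.
Qed.

HB.instance Definition _ := GRing.isSubmodClosed.Build R (linfty Omega X)
  cspace_pred cspace_submod_closed.

Record cspace := Cspace {
  cspace_val :> linfty Omega X ;
  cspace_valP : cspace_val \in cspace_pred }.

HB.instance Definition _ := [isSub for cspace_val].
HB.instance Definition _ := [Choice of cspace by <:].
HB.instance Definition _ := [SubChoice_isSubLmodule of cspace by <:].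

Definition cspace_norm (xi : cspace) : R := `|cspace_val xi|.

Lemma cspace_ler_normD (x y : cspace) :
  cspace_norm (x + y) <= cspace_norm x + cspace_norm y.
Proof. exact: ler_normD. Qed.

Lemma cspace_normZ (l : R) (x : cspace) :
  cspace_norm (l *: x) = `|l| * cspace_norm x.
Proof. exact: normrZ. Qed.

Lemma cspace_norm0_eq0 (x : cspace) : cspace_norm x = 0 -> x = 0.
Proof. by move=> x0; apply/val_inj/normr0_eq0. Qed.

HB.instance Definition _ := Lmodule_isNormed.Build R cspace
  cspace_ler_normD cspace_normZ cspace_norm0_eq0.

End Cspace.

Section Completeness.
Context {R : realType} (Omega : Type) (X : completeNormedModType R).

Lemma linfty_complete (F : set_system (linfty Omega X)) :
  ProperFilter F -> cauchy F -> cvg F.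
Proof.
move=> FF /cauchyP cF.
have ev_lt (w : Omega) (xi eta : linfty Omega X) (e : R) :
    ball xi e eta -> `|xi w - eta w| < e.
  by rewrite -ball_normE /=; apply: le_lt_trans (linfty_norm_ub (xi - eta) w).
have cw (w : Omega) : cvg ((fun xi : linfty Omega X => xi w) @ F).
  apply: cauchy_cvg; apply/cauchy_exP => e e0.
  have [xi h] := cF e e0; exists (xi w).
  rewrite /= nbhs_simpl; apply: filterS h => eta h.
  by rewrite -ball_normE; exact: ev_lt.
pose g w : X := lim ((fun xi : linfty Omega X => xi w) @ F).
have gP (xi : linfty Omega X) (e : R) w :
    F (ball xi e) -> `|xi w - g w| <= e.
  move=> h; apply/ler_addgt0Pr => d d0.
  have h2 : F [set eta : linfty Omega X | `|g w - eta w| < d].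
    by apply: cvgr_dist_lt d0; exact: cw.
  have [eta [/(ev_lt w) h3 h4]] := filter_ex (filterI h h2).
rewrite (le_trans (ler_distD (eta w) _ _)) // lerD ?ltW //.
by rewrite distrC.
have gb : g \in @linfty_pred R Omega X.
  apply/linfty_predP; have [xi h] := cF 1 ltr01.
  exists (1 + `|xi|) => w.
  rewrite -[g w](subrK (xi w)) (le_trans (ler_normD _ _)) //.
  rewrite lerD ?linfty_norm_ub // distrC; exact: gP.
apply/cvg_ex; exists (Linfty gb); apply/cvg_ballP => e e0.
have e20 : 0 < e / 2 by rewrite divr_gt0.
have [xi h] := cF _ e20; apply: filterS (h) => eta.
rewrite -!ball_normE /= => xe.
rewrite (le_lt_trans (ler_distD xi _ _)) // [ltRHS]splitr ler_ltD //.
apply: linfty_norm_le; first exact: ltW.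
by move=> w; rewrite /= distrC; exact: gP.
Qed.

HB.instance Definition _ :=
  Uniform_isComplete.Build (linfty Omega X) linfty_complete.

Lemma cspace_closed : closed [set` @cspace_pred R Omega X].
Proof.
move=> xi cxi; rewrite /= inE /=.
have [finO|infO] := pselect (finite_set [set: Omega]).
  by exists 0 => e e0; exact: sub_finite_set finO.
pose G : set_system Omega := [set A | finite_set (~` A)].
have FG : ProperFilter G.
  split; first by rewrite /G /= setC0.
  split.
  - by rewrite /G /= setCT.
  - by move=> A B; rewrite /G /= setCI finite_setU.
  - by move=> A B AB; apply: sub_finite_set; exact: subsetC.
have : cvg (xi @ G).
  apply: cauchy_cvg; apply/cauchy_exP => e e0.
  have e20 : 0 < e / 2 by rewrite divr_gt0.
  have [eta []] := cxi _ (nbhsx_ballx xi _ e20).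
  rewrite /= inE /= => -[x /(_ _ e20) hx].
  rewrite -ball_normE /= => h; exists x.
  rewrite /= nbhs_simpl /G /=; apply: sub_finite_set hx => w /=.
  rewrite -ball_normE /= leNgt => h2; apply/negP => h3; apply: h2.
  rewrite (le_lt_trans (ler_distD (eta w) _ _)) // [ltRHS]splitr.
  rewrite ltrD //; first by rewrite distrC.
  rewrite distrC; exact: le_lt_trans (linfty_norm_ub (xi - eta) w) h.
move=> /cvg_ex[/= x hx]; exists x => e e0.
have : G [set w | `|x - xi w| < e] by move/cvgrPdist_lt: hx => /(_ _ e0).
rewrite /G /=; apply: sub_finite_set => w /= h.
by apply/negP; rewrite -leNgt distrC.
Qed.

Lemma cspace_complete (F : set_system (cspace Omega X)) :
  ProperFilter F -> cauchy F -> cvg F.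
Proof.
move=> FF /cauchyP cF.
have : cvg (@cspace_val R Omega X @ F).
  apply: cauchy_cvg; apply/cauchy_exP => e e0.
  have [xi h] := cF e e0; exists (cspace_val xi).
  rewrite /= nbhs_simpl; apply: filterS h => eta.
  by rewrite -!ball_normE.
move=> /cvg_ex[/= xi hxi].
have xiP : xi \in @cspace_pred R Omega X.
  apply: (closed_cvg _ cspace_closed _ _ hxi).
  by apply: nearW => eta; exact: cspace_valP.
apply/cvg_ex; exists (Cspace xiP); apply/cvg_ballP => e e0.
move/cvgrPdist_lt: hxi => /(_ _ e0).
by rewrite /prop_near1; apply: filterS => eta; rewrite -ball_normE.
Qed.

HB.instance Definition _ :=
  Uniform_isComplete.Build (cspace Omega X) cspace_complete.

End Completeness.

Definition is_cone {R : realType} {V : lmodType R} (C : set V) : Prop :=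
  [/\ C !=set0,
      forall x y, C x -> C y -> C (x + y)
    & forall (l : R) x, 0 <= l -> C x -> C (l *: x)].

Definition positively_homogeneous {R : realType} {V W : lmodType R}
    (f : V -> W) : Prop :=
  forall (l : R) (v : V), 0 <= l -> f (l *: v) = l *: f v.

Definition bigcap_translates {R : realType} {Omega : Type} {X : lmodType R}
    (C : Omega -> set X) (xi : Omega -> X) : set X :=
  \bigcap_(w in [set: Omega]) [set xi w + c | c in C w].

(* Main.v *)
From HB Require Import structures.
Require Import Defs.
From mathcomp Require Import all_boot all_order all_algebra.
From mathcomp Require Import all_classical all_reals all_analysis.
From mathcomp Require Import ring lra wochoice.
Set Implicit Arguments.
Unset Strict Implicit.
Unset Printing Implicit Defensive.

Import Order.TTheory GRing.Theory Num.Theory.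
Import numFieldNormedType.Exports.
Local Open Scope classical_set_scope.
Local Open Scope ring_scope.

(** Both equivalences are instances of one fact about a Banach space [Z] with
evaluation maps [xi |-> xi w] into [X]. The pairs [(xi, y)] in [Z * X] with [y]
in the intersection of the translates [xi w + C w] form a closed cone [G], and
condition (1) says that the first projection maps [G] onto [Z]. So everything
follows from an open mapping theorem for cones, [cone_continuous_section]: if
[T : W -> Z] is a continuous linear map of Banach spaces and [G] is a closed
cone of [W] with [T G = Z], then [T] has a continuous, positively homogeneous
section with values in [G] and norm at most [K * `|z|]. This gives (1) -> (3);
(3) -> (2) and (2) -> (1) are immediate.

The section is obtained from an approximate one by successive correction. If
[h : Z -> W] is continuous, positively homogeneous, has values in [G], and
leaves a remainder [r z = z - T (h z)] of norm at most [`|z| / 2], then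
[h z + h (r z) + h (r (r z)) + ...] converges geometrically to an exact
section, which inherits continuity and homogeneity from [h] and stays in [G]
because [G] is a closed cone ([section_of_approximate_section]).

An approximate section need not solve anything exactly, so it may be built by
averaging. Baire's theorem gives for every [i] some [a i] in [G], of norm at
most [K * `|i|], whose image is close to [i] ([cone_almost_open]); since [G] is
not symmetric, the usual passage from a ball around some point to a ball around
the origin uses an exact preimage of the opposite of the centre. The choice of
[a] is not continuous, but [Z], as a metric space, carries a partition of unity
subordinate to its balls of a given radius, so [a] can be replaced by a
continuous local mean ([continuous_local_mean]). Closed convex constraints
(lying in [G], in a ball, having image near [z]) survive the averaging. The
mean is used on the unit sphere only and extended to [Z] radially, which makes
it homogeneous.

The partition of unity is Stone's. A well-ordering of [Z] selects for every
point a ball containing it; at each dyadic scale, the points deep inside their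
selected ball split into uniformly separated classes, one for each ball, so
that near any point at most one class is active per scale. The scales are then
summed with geometrically decreasing weights, and uniform convergence replaces
local finiteness. *)

(** * Series dominated by a geometric series *)

Section GeometricSeries.
Context {R : realType} {V : completeNormedModType R}.
Implicit Types (u : V^nat) (M : R).

Lemma half_normr_lt1 : `|2^-1 : R| < 1.
Proof. by rewrite ger0_norm// invf_lt1// ltr1n. Qed.

Lemma geometric_bound_ge0 u M : (forall n, `|u n| <= M * 2^-1 ^+ n) -> 0 <= M.
Proof. by move=> /(_ 0%N); rewrite expr0 mulr1; apply: le_trans. Qed.

Lemma is_cvg_series_geometric u M :
  (forall n, `|u n| <= M * 2^-1 ^+ n) -> cvgn (series u).
Proof.
move=> uM; have M0 := geometric_bound_ge0 uM; apply: normed_cvg.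
apply: (@series_le_cvg _ _ (geometric M 2^-1)) => //= [n|].
- by rewrite mulr_ge0// exprn_ge0// invr_ge0.
- exact/is_cvg_geometric_series/half_normr_lt1.
Qed.

(** The bound on the tail depends on [M] and [N] only: this uniformity is what
lets continuity pass to the sum. *)
Lemma series_geometric_tail u M N :
  (forall n, `|u n| <= M * 2^-1 ^+ n) ->
  `|limn (series u) - series u N| <= 2 * M * 2^-1 ^+ N.
Proof.
move=> uM; have cu := is_cvg_series_geometric uM.
have M0 := geometric_bound_ge0 uM.
have step k : `|series u (N + k)%N - series u N| <=
    2 * M * (2^-1 ^+ N - 2^-1 ^+ (N + k)).
  elim: k => [|k IH]; first by rewrite addn0 !subrr normr0 mulr0.
  rewrite addnS seriesSr addrAC (le_trans (ler_normD _ _))//.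
  rewrite (le_trans (lerD IH (uM _)))// exprS le_eqVlt; apply/orP; left.
  by apply/eqP; field.
have cd : (fun n => series u n - series u N) @ \oo -->
    limn (series u) - series u N.
  by apply: cvgB => //; exact: cvg_cst.
apply: (cvgr_to_le (cvg_norm cd)); exists N => // n /= Nn.
rewrite -(subnKC Nn) (le_trans (step _))// ler_wpM2l ?mulr_ge0//.
by rewrite lerBlDr lerDl exprn_ge0// invr_ge0.
Qed.

Lemma series_geometric_norm u M :
  (forall n, `|u n| <= M * 2^-1 ^+ n) -> `|limn (series u)| <= 2 * M.
Proof.
move=> /(series_geometric_tail 0).
by rewrite seriesEnat/= big_geq// subr0 expr0 mulr1.
Qed.

(** The domination is required only near [x], since the averages below are
bounded locally but not globally. *)
Lemma series_geometric_continuous {T : topologicalType} (u : nat -> T -> V)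
    M (x : T) :
  (\forall y \near x, forall n, `|u n y| <= M * 2^-1 ^+ n) ->
  (forall n, {for x, continuous (u n)}) ->
  {for x, continuous (fun y => limn (series (u^~ y)))}.
Proof.
move=> uM cu; apply/cvgrPdist_lt => e e0.
have e30 : 0 < e / 3 by rewrite divr_gt0.
have [N hN] : exists N, 2 * M * 2^-1 ^+ N < e / 3.
  have /cvgr0Pnorm_lt/(_ _ e30) [N _ /(_ N (leqnn N))] :
    geometric (2 * M) 2^-1 @ \oo --> (0 : R).
    by apply: cvg_geometric; exact: half_normr_lt1.
  by move=> h; exists N; apply: le_lt_trans h; exact: ler_norm.
have cS : {for x, continuous (fun y => series (u^~ y) N)}.
  elim: N {hN} => [|N IH].
    rewrite (_ : (fun y => _) = fun=> 0); first exact: cvg_cst.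
    by apply/funext => y; rewrite seriesEnat/= big_geq.
  rewrite (_ : (fun y => _) = (fun y => series (u^~ y) N + u N y)).
    by apply: cvgD; [exact: IH|exact: cu].
  by apply/funext => y; rewrite seriesSr.
have tail y : (forall n, `|u n y| <= M * 2^-1 ^+ n) ->
    `|limn (series (u^~ y)) - series (u^~ y) N| < e / 3.
  by move=> /(series_geometric_tail N) h; exact: le_lt_trans hN.
have {}cS := cvgr_dist_lt _ _ cS _ e30.
near=> y.
have -> : e = e / 3 + (e / 3 + e / 3) by field.
rewrite (le_lt_trans (ler_distD (series (u^~ x) N) _ _))// ltrD//.
  by apply: tail; exact: nbhs_singleton uM.
rewrite (le_lt_trans (ler_distD (series (u^~ y) N) _ _))// ltrD//.
  by near: y; exact: cS.
by rewrite distrC; apply: tail; near: y; exact: uM.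
Unshelve. all: by end_near. Qed.

End GeometricSeries.

(** * Infinite convex combinations *)

Section ConvexSeries.
Context {R : realType} {W : normedModType R} (A : set W).
Hypothesis A_closed : closed A.
Hypothesis A_convex : convex_set (A : set (convex_lmodType W)).

Lemma convex_mean2 (p q : R) (x y : W) :
  0 < p -> 0 < q -> A x -> A y -> A ((p + q)^-1 *: (p *: x + q *: y)).
Proof.
move=> p0 q0 Ax Ay; have pq0 : 0 < p + q by rewrite addr_gt0.
have l0 : 0 <= p / (p + q) by rewrite divr_ge0// ltW.
have l1 : p / (p + q) <= 1 by rewrite ler_pdivrMr// mul1r lerDl ltW.
have := @A_convex x y (Itv01 l0 l1); rewrite !inE => /(_ Ax Ay).
congr A; rewrite scalerDr !scalerA/=; congr (_ *: _ + _ *: _).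
  by rewrite [RHS]mulrC.
by rewrite -[LHS]/(1 - p / (p + q)); field; rewrite gt_eqF.
Qed.

(** The weights are not normalized; dividing by their sum [P] at the end avoids
normalizing a partition of unity. *)
Lemma convex_series_mean (p : R^nat) (w : W^nat) (P : R) (S : W) :
  (forall n, 0 <= p n) -> (forall n, 0 < p n -> A (w n)) ->
  series p @ \oo --> P -> 0 < P ->
  series (fun n => p n *: w n) @ \oo --> S -> A (P^-1 *: S).
Proof.
move=> p0 Aw cP P0 cS.
(* Normalized partial sums make sense only once a weight is positive. *)
have mean n : series p n = 0 /\ series (fun n => p n *: w n) n = 0 \/
    0 < series p n /\ A ((series p n)^-1 *: series (fun n => p n *: w n) n).
  elim: n => [|n IH]; first by left; rewrite !seriesEnat/= !big_geq.
  rewrite !seriesSr; have [<-|pn] := eqVneq 0 (p n).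
    by rewrite scale0r !addr0.
  have {pn} pn : 0 < p n by rewrite lt0r eq_sym pn p0.
  right; case: IH => -[+ +].
    by move=> -> ->; rewrite !add0r scalerA mulVf ?gt_eqF// scale1r; split => //; exact: Aw.
  move=> s0 As; split; first by rewrite addr_gt0.
  have := convex_mean2 s0 pn As (Aw _ pn).
  by rewrite scalerA divff ?gt_eqF// scale1r.
have cPS : (fun n => (series p n)^-1 *: series (fun n => p n *: w n) n) @ \oo
    --> P^-1 *: S.
  by apply: cvgZ cS; apply: cvgV cP; rewrite gt_eqF.
apply: (closed_cvg A A_closed _ _ cPS).
apply: filterS (cvgr_gt _ cP _ P0) => n sn.
by case: (mean n) => -[// s0]; rewrite s0 ltxx in sn.
Qed.

End ConvexSeries.

(** * Continuous local means *)

Section Tent.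
Context {R : realType} {Z : normedModType R} (D : set Z) (d : R).

(** This is the positive part of [d] minus the distance from [x] to [D]. Since
[sup set0 = 0], it also has the right value 0 when [D] is empty. *)
Definition tent (x : Z) : R := sup [set Num.max 0 (d - `|x - y|) | y in D].

Lemma tent_le (x : Z) (M : R) :
  0 <= M -> (forall y, D y -> d - `|x - y| <= M) -> tent x <= M.
Proof.
move=> M0 DM; have [E|/set0P ne] :=
  eqVneq [set Num.max 0 (d - `|x - y|) | y in D] set0.
  by rewrite /tent E sup0.
by apply: ge_sup => // _ [y Dy <-]; rewrite ge_max M0 DM.
Qed.

Lemma tent_ub (x y : Z) : D y -> Num.max 0 (d - `|x - y|) <= tent x.
Proof.
move=> Dy; apply: ub_le_sup; last by exists y.
exists (Num.max 0 d) => _ [z _ <-].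
by rewrite ge_max le_max lexx/= le_max orbC gerBl normr_ge0.
Qed.

Lemma tent_ge0 (x : Z) : 0 <= tent x.
Proof.
have [E|/set0P[y Dy]] := eqVneq D set0; first by rewrite /tent E image_set0 sup0.
by apply: le_trans (tent_ub x Dy); rewrite le_max lexx.
Qed.

Lemma tent_lipschitz (x y : Z) : `|tent x - tent y| <= `|x - y|.
Proof.
wlog le_yx : x y / tent y <= tent x => [H|].
  have [/H//|/ltW/H] := leP (tent y) (tent x).
  by rewrite distrC (distrC y).
rewrite ger0_norm ?subr_ge0// lerBlDr; apply: tent_le.
  by rewrite addr_ge0// tent_ge0.
move=> z Dz; rewrite -lerBlDl; apply: le_trans (tent_ub y Dz).
rewrite le_max; apply/orP; right.
by rewrite -addrA -opprD lerD2l lerN2 [leRHS]addrC (distrC x) ler_distD.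
Qed.

Lemma tent_gt0 (x : Z) : 0 < tent x -> exists2 y, D y & `|x - y| < d.
Proof.
move=> b0; apply/not_exists2P => H; move: b0; apply/negP; rewrite -leNgt.
by apply: tent_le => // y Dy; case: (H y) => // /negP; rewrite -leNgt subr_le0.
Qed.

End Tent.

(** Take for [c x] the least centre, in some well-ordering of [Z], of a ball of
radius [e] containing [x]. If each of [x] and [y] lies in the ball selected by
the other, then each of the two centres is at most the other. This is the only
trace of the well-ordering that is used below. *)
Lemma ball_selector {R : realType} {Z : normedModType R} (e : R) : 0 < e ->
  exists2 c : Z -> Z, forall x, `|x - c x| < e &
    forall x y, `|y - c x| < e -> `|x - c y| < e -> c x = c y.
Proof.
move=> e0; have [Q Qwo] := well_ordering_principle Z.
pose B x : {pred Z} := [pred j | `|x - j| < e].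
have least x : exists j, minimum_of Q (B x) j.
  have [|j [Bj _]] := Qwo (B x); last by exists j.
  by exists x; rewrite inE/= subrr normr0.
have [c cP] := choice least; exists c.
  by move=> x; have [] := cP x; rewrite inE.
move=> x y ycx xcy.
have Qxy : Q (c x) (c y) by have [_] := cP x; apply; rewrite inE.
have Qyx : Q (c y) (c x) by have [_] := cP y; apply; rewrite inE.
have refl z : Q (c z) (c z) by have [Bz] := cP z; apply.
have [|z [_ zU]] := Qwo (pred2 (c x) (c y)).
  by exists (c x); rewrite inE eqxx.
have mx : minimum_of Q (pred2 (c x) (c y)) (c x).
  by split; rewrite ?inE ?eqxx// => j; rewrite inE => /orP[] /eqP ->.
have my : minimum_of Q (pred2 (c x) (c y)) (c y).
  by split; rewrite ?inE ?eqxx ?orbT// => j; rewrite inE => /orP[] /eqP ->.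
by rewrite -(zU _ mx) -(zU _ my).
Qed.

Section LocalMean.
Context {R : realType} {Z : normedModType R} {W : completeNormedModType R}.

(** At scale [d n], let [D n] be the set of points [y] at depth at least [3 d n]
in their selected ball. Two points of [D n] at distance less than [3 d n] lie in
each other's selected ball and so select the same one: within distance [d n] of
[D n], the selected centre is therefore well defined and locally constant. The
mean gives the value of [a] at this centre the weight [p n], positive exactly at
distance less than [d n] from [D n]. Since [d n] tends to 0, every point lies in
some [D n] and has positive total weight.

The conclusion speaks of all closed convex [A] at once: [h x] lies in the closed
convex hull of the values of [a] in the ball of radius [e] around [x]. *)
Lemma continuous_local_mean (a : Z -> W) (e : R) : 0 < e ->
  (forall r, exists M, forall i, `|i| <= r -> `|a i| <= M) ->
  exists2 h : Z -> W, continuous h &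
    forall x (A : set W), closed A ->
      convex_set (A : set (convex_lmodType W)) ->
      (forall i, `|x - i| < e -> A (a i)) -> A (h x).
Proof.
move=> e0 a_bnd; have [c cx c_eq] := @ball_selector R Z e e0.
pose d n : R := 2^-1 ^+ n.
have d0 n : 0 < d n by rewrite exprn_gt0// invr_gt0.
pose D n : set Z := [set y | `|y - c y| + 3 * d n <= e].
pose p n x := tent (D n) (d n) x.
have p_le n x : p n x <= d n.
  apply: tent_le => [|y _]; first exact: ltW.
  by rewrite gerBl normr_ge0.
have p_ge0 n x : 0 <= p n x by exact: tent_ge0.
(* The centre active at [x] on scale [n]; its value matters only if [0 < p n x]. *)
pose s n (x : Z) := c (xget x [set y | D n y /\ `|x - y| < d n]).
have sP n x : 0 < p n x -> exists y, [/\ D n y, `|x - y| < d n & s n x = c y].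
  move=> /tent_gt0[y Dy xy].
  have [] := @xgetPex _ x [set y | D n y /\ `|x - y| < d n].
    by exists y.
  by move=> Dz xz; exists (xget x [set y | D n y /\ `|x - y| < d n]).
have s_near n x : 0 < p n x -> `|x - s n x| < e.
  move=> /sP[y [Dy xy ->]]; apply: lt_le_trans Dy.
  rewrite (le_lt_trans (ler_distD y _ _))// addrC ltrD2l (lt_le_trans xy)//.
  by rewrite ler_peMl ?ltW// ltr1n.
(* Points [u], [v] of [D n] that witness [p n x] and [p n y] are at distance
   less than [3 * d n]. *)
have s_loc n x y : `|x - y| < d n -> 0 < p n x -> 0 < p n y -> s n x = s n y.
  have key u v x' y' : `|x' - y'| < d n -> D n u -> `|x' - u| < d n ->
      `|y' - v| < d n -> `|v - c u| < e.
    move=> xy Du xu yv; apply: lt_le_trans Du.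
    rewrite (le_lt_trans (ler_distD u _ _))// addrC ltrD2l.
    rewrite (le_lt_trans (ler_distD y' _ _))//.
    rewrite (_ : 3 * d n = d n + (d n + d n)); last by ring.
    rewrite ltrD//; first by rewrite distrC.
    by rewrite (le_lt_trans (ler_distD x' _ _))// ltrD// distrC.
  move=> xy /sP[u [Du xu ->]] /sP[v [Dv yv ->]]; apply: c_eq.
    exact: (key u v x y).
  by apply: (key v u y x) => //; rewrite distrC.
pose u n x := p n x *: a (s n x).
have u_bnd (x0 : Z) : exists2 M : R, 0 <= M & forall x, `|x0 - x| < 1 -> forall n,
    0 < p n x -> `|a (s n x)| <= M.
  have [M aM] := a_bnd (`|x0| + 1 + e); exists (Num.max 0 M).
    by rewrite le_max lexx.
  move=> x x0x n pn; rewrite le_max aM ?orbT//.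
  rewrite -[s n x](subrK x) (le_trans (ler_normD _ _))// addrC lerD//.
    rewrite -[x in `|x|](subrK x0) (le_trans (ler_normD _ _))// addrC lerD//.
    by rewrite distrC ltW.
  by rewrite distrC ltW// s_near.
have u_dom (x0 : Z) : exists M : R, \forall x \near x0, forall n,
    `|u n x| <= M * 2^-1 ^+ n.
  have [M M0 aM] := u_bnd x0; exists M.
  near=> x; move=> n; rewrite normrZ ger0_norm// mulrC.
  have [<-|pn] := eqVneq 0 (p n x).
    by rewrite mulr0 mulr_ge0// ltW// d0.
  have {}pn : 0 < p n x by rewrite lt0r eq_sym pn p_ge0.
  apply: ler_pM => //.
  by apply: aM => //; near: x; exact: cvgr_dist_lt.
(* Where [p n] vanishes the active centre may jump, but there the weight is at
   most the distance to the zero, so [u n] is locally Lipschitz all the same. *)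
have cu n : continuous (u n).
  move=> x0; have [M M0 aM] := u_bnd x0; apply/cvgrPdist_lt => r r0.
  have M10 : 0 < M + 1 by rewrite ltr_wpDl.
  near=> x.
  have xr : `|x0 - x| < r / (M + 1).
    by near: x; apply: cvgr_dist_lt => //; rewrite divr_gt0.
  have x1 : `|x0 - x| < 1 by near: x; exact: cvgr_dist_lt.
  have xd : `|x0 - x| < d n by near: x; exact: cvgr_dist_lt.
  suff : `|u n x0 - u n x| <= `|x0 - x| * M.
    move=> /le_lt_trans; apply.
    rewrite (@le_lt_trans _ _ (`|x0 - x| * (M + 1)))//.
      by rewrite ler_wpM2l// lerDl.
    by rewrite -ltr_pdivlMr.
  have lip := tent_lipschitz (D n) (d n) x0 x.
  have aM0 : 0 < p n x0 -> `|a (s n x0)| <= M.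
    by apply: aM; rewrite subrr normr0.
  rewrite /u -/(p n x0) -/(p n x) in lip *.
  have [E0|p0] := eqVneq 0 (p n x0); have [E|px] := eqVneq 0 (p n x).
  - by rewrite -E0 -E !scale0r subrr normr0 mulr_ge0.
  - rewrite -E0 scale0r sub0r normrN normrZ -[`|p n x|]normrN -sub0r E0.
    by rewrite ler_pM// aM// lt0r eq_sym px p_ge0.
  - rewrite -E scale0r subr0 normrZ -[p n x0]subr0 E.
    by rewrite ler_pM// aM0// lt0r eq_sym p0 p_ge0.
  - rewrite -(s_loc n x0 x)// ?lt0r 1?eq_sym ?p0 ?px ?p_ge0//.
    by rewrite -scalerBl normrZ ler_pM// aM0// lt0r eq_sym p0 p_ge0.
have p_dom x : forall n, `|p n x| <= 1 * 2^-1 ^+ n.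
  by move=> n; rewrite ger0_norm// mul1r p_le.
have cp n : continuous (p n).
  move=> x; apply/cvgrPdist_lt => r r0; near=> y.
  apply: le_lt_trans (tent_lipschitz _ _ _ _) _.
  by near: y; exact: cvgr_dist_lt.
pose P x : R := limn (series (p^~ x)).
have cvgP x : series (p^~ x) @ \oo --> P x.
  exact: (is_cvg_series_geometric (p_dom x)).
have P0 x : 0 < P x.
  have [n hn] : exists n, d n < (e - `|x - c x|) / 3.
    have e1 : 0 < (e - `|x - c x|) / 3 by rewrite divr_gt0// subr_gt0.
    have /cvgr0Pnorm_lt/(_ _ e1) [N _ /(_ N (leqnn N))] :
      geometric 1 2^-1 @ \oo --> (0 : R).
      by apply: cvg_geometric; exact: half_normr_lt1.
    by move=> h; exists N; apply: le_lt_trans h; rewrite /= mul1r ler_norm.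
  have Dx : D n x.
    by rewrite /D/= -lerBrDl mulrC -ler_pdivlMr// ltW.
  have px : 0 < p n x.
    apply: lt_le_trans (tent_ub _ x Dx).
    by rewrite lt_max subrr normr0 subr0 d0 orbT.
  have nd : nondecreasing_seq (series (p^~ x)).
    by apply: nondecreasing_series => k _ _; exact: p_ge0.
  have := nondecreasing_cvgn_le nd (is_cvg_series_geometric (p_dom x)) n.+1.
  apply: lt_le_trans; rewrite seriesSr ltr_wpDl//.
  by rewrite /series/= sumr_ge0.
exists (fun x => (P x)^-1 *: limn (series (u^~ x))).
  move=> x; apply: cvgZ.
    apply: cvgV; first by rewrite gt_eqF.
    apply: (@series_geometric_continuous _ _ _ _ 1) => [|n]; last exact: cp.
    by near=> y; exact: p_dom.
  have [M uM] := u_dom x.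
  by apply: (series_geometric_continuous uM) => n; exact: cu.
move=> x A A_closed A_convex Aa.
have [M uM] := u_dom x.
apply: (convex_series_mean A_closed A_convex _ _ (cvgP x) (P0 x)).
- by move=> n; exact: p_ge0.
- by move=> n /s_near; exact: Aa.
- exact: (is_cvg_series_geometric (nbhs_singleton uM)).
Unshelve. all: by end_near. Qed.

End LocalMean.

(** * Almost openness of a linear map on a cone *)

Section ConeSections.
Context {R : realType} {W Z : completeNormedModType R}.
Variables (G : set W) (T : {linear W -> Z}).
Hypothesis G_cone : is_cone G.

(** The images [B n] of the points of [G] of norm at most [n] cover [Z], so by
Baire's theorem the closure of some [B n] contains a ball around a point [z0].
Adding a preimage of [- z0] taken in [G] moves this ball to the origin, and
scaling, which preserves [G], moves any [z] into it. *)
Lemma cone_almost_open : (forall z, exists2 w, G w & T w = z) ->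
  exists2 K : R, 0 < K & forall z e, 0 < e ->
    exists w, [/\ G w, `|w| <= K * `|z| & `|z - T w| <= e].
Proof.
case: G_cone => -[g0 Gg0] GD GZ TG.
pose B n : set Z := T @` [set w | G w /\ `|w| <= n%:R].
have [n nd] : exists n, ~ dense (~` closure (B n)).
  apply/not_existsP => H.
  have /(_ setT) : dense (\bigcap_n ~` closure (B n)).
    apply: Baire => n; split; first exact/closed_openC/closed_closure.
    by have /contrapT := H n.
  case=> [||z [_ hz]]; [by exists 0 | exact: openT |].
  have [w Gw wz] := TG z.
  have [m wm] : exists m, `|w| <= m%:R.
    by exists (Num.bound `|w|); rewrite ltW// archi_boundP.
  by apply: (hz m) => //; apply: subset_closure; exists w.
have [z0 [r r0 hr]] : exists z0, exists2 r : R, 0 < r &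
    forall y, `|z0 - y| < r -> closure (B n) y.
  apply: contrapT => H; apply: nd => O [z Oz] oO; apply: contrapT => OB.
  apply: H; exists z; have /nbhs_ballP[r /= r0 rO] : nbhs z O.
    exact: open_nbhs_nbhs.
  exists r => // y zy; apply: contrapT => By; apply: OB; exists y; split => //.
  by apply: rO; rewrite -ball_normE.
have [w0 Gw0 Tw0] := TG (- z0).
pose c := n%:R + `|w0| + 1.
have c0 : 0 < c by rewrite ltr_wpDl// addr_ge0.
exists (c * (2 / r)); first by rewrite mulr_gt0// divr_gt0.
move=> z e e0; have [->|z_neq0] := eqVneq z 0.
  exists 0; split; last by rewrite linear0 subr0 normr0 ltW.
    by rewrite -(scale0r g0); exact: GZ.
  by rewrite !normr0 mulr0.
have nz0 : 0 < `|z| by rewrite normr_gt0.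
(* Scaled by [t^-1], the vector [z] has norm [r / 2]. *)
pose t := 2 * `|z| / r.
have t0 : 0 < t by rewrite divr_gt0// mulr_gt0.
have : closure (B n) (z0 + t^-1 *: z).
  apply: hr; rewrite opprD addrA subrr sub0r normrN normrZ normfV gtr0_norm//.
  rewrite mulrC ltr_pdivrMr// (_ : r * t = 2 * `|z|); first by lra.
  by rewrite /t; field; rewrite gt_eqF.
move=> /(_ (ball (z0 + t^-1 *: z) (e / t))) [|y [[w [Gw wn] <-]]].
  by apply: nbhsx_ballx; rewrite divr_gt0.
rewrite -ball_normE /= => hw; exists (t *: (w + w0)); split.
- by apply: GZ; [exact: ltW|exact: GD].
- rewrite normrZ gtr0_norm// mulrC -mulrA [2 / r * _]mulrAC ler_pM2r//.
  rewrite (le_trans (ler_normD _ _))// /c.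
  by rewrite (le_trans (lerD wn (lexx _)))// lerDl.
- rewrite linearZ linearD/= Tw0.
  have -> : z - t *: (T w - z0) = t *: (z0 + t^-1 *: z - T w).
    rewrite [RHS]scalerBr [in RHS]scalerDr scalerA divff ?gt_eqF// scale1r.
    by rewrite scalerBr opprB addrA (addrC z).
  by rewrite normrZ gtr0_norm// mulrC -ler_pdivlMr// ltW.
Qed.

(** * From approximate to exact sections *)

Hypothesis G_closed : closed G.

Lemma cone_series_lim (u : W^nat) :
  (forall n, G (u n)) -> cvgn (series u) -> G (limn (series u)).
Proof.
case: G_cone => -[g0 Gg0] GD GZ Gu cu.
apply: (closed_cvg G G_closed _ _ cu); apply: nearW => n.
elim: n => [|n IH]; last by rewrite seriesSr; exact: GD.
by rewrite seriesEnat/= big_geq// -(scale0r g0); exact: GZ.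
Qed.

Hypothesis T_cont : continuous T.

(** The partial sums satisfy [T (s_n z) = z - iter n r z], and the remainder is
at least halved at each step. *)
Lemma section_of_approximate_section (h : Z -> W) (K : R) :
  0 <= K -> continuous h -> positively_homogeneous h ->
  (forall z, [/\ G (h z), `|h z| <= K * `|z| & `|z - T (h z)| <= 2^-1 * `|z|]) ->
  exists s : Z -> W, [/\ continuous s, positively_homogeneous s
    & forall z, [/\ G (s z), T (s z) = z & `|s z| <= 2 * K * `|z|] ].
Proof.
move=> K0 ch hh hP.
pose r z := z - T (h z).
have r_norm n z : `|iter n r z| <= 2^-1 ^+ n * `|z|.
  elim: n => [|n IH]; first by rewrite expr0 mul1r.
  rewrite iterS; have [_ _] := hP (iter n r z); move/le_trans; apply.
  by rewrite exprS -mulrA ler_wpM2l// invr_ge0.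
have r_hom n l z : 0 <= l -> iter n r (l *: z) = l *: iter n r z.
  move=> l0; elim: n => // n IH.
  by rewrite !iterS IH /r hh// linearZ scalerBr.
have r_cont n : continuous (iter n r).
  elim: n => [|n IH] z; first exact: cvg_id.
  rewrite (_ : iter n.+1 r = r \o iter n r)//.
  apply: continuous_comp; first exact: IH.
  rewrite /r; apply: cvgB; first exact: cvg_id.
  by apply: continuous_comp; [exact: ch|exact: T_cont].
pose u n z := h (iter n r z).
have u_norm z n : `|u n z| <= K * `|z| * 2^-1 ^+ n.
  have [_ le_h _] := hP (iter n r z); apply: (le_trans le_h).
  by rewrite -mulrA ler_wpM2l// mulrC.
have cvgu z : cvgn (series (u^~ z)) := is_cvg_series_geometric (u_norm z).
exists (fun z => limn (series (u^~ z))); split.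
- move=> z; apply: (@series_geometric_continuous _ _ _ _ (K * (`|z| + 1))).
    near=> y; move=> n; apply: (le_trans (u_norm y n)).
    rewrite ler_wpM2r ?exprn_ge0 ?invr_ge0// ler_wpM2l//.
    rewrite -[y in `|y|](subrK z) (le_trans (ler_normD _ _))// [leRHS]addrC lerD//.
  by move=> n; apply: (@continuous_comp _ _ _ (iter n r) h); [exact: r_cont|exact: ch].
- move=> l z l0.
  have -> : series (u^~ (l *: z)) = (fun n => l *: series (u^~ z) n).
    apply/funext => n; rewrite /series/= scaler_sumr; apply: eq_bigr => k _.
    by rewrite /u r_hom// hh.
  exact: limZl_tmp.
- move=> z; split.
  + by apply: cone_series_lim => // n; have [] := hP (iter n r z).
  + have TS n : T (series (u^~ z) n) = z - iter n r z.
      elim: n => [|n IH]; first by rewrite seriesEnat/= big_geq// linear0 subrr.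
      by rewrite seriesSr linearD/= IH /u /r opprB addrA addrAC.
    have c1 : (fun n => T (series (u^~ z) n)) @ \oo --> T (limn (series (u^~ z))).
      by apply: (cvg_comp _ _ (cvgu z)); exact: T_cont.
    have c2 : (fun n => z - iter n r z) @ \oo --> z - 0.
      apply: cvgB; first exact: cvg_cst.
      apply: norm_cvg0.
      apply: (@squeeze_cvgr _ _ _ _ (fun=> 0) (geometric `|z| 2^-1)).
      * by apply: nearW => n; rewrite normr_ge0/= mulrC.
      * exact: cvg_cst.
      * by apply: cvg_geometric; exact: half_normr_lt1.
    rewrite subr0 in c2; move: c1; rewrite (funext TS) => c1.
    exact: (cvg_unique _ c1 c2).
  + by rewrite -mulrA; exact: series_geometric_norm.
Unshelve. all: by end_near. Qed.

End ConeSections.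

(** * Radial extension from the unit sphere *)

Section RadialExtension.
Context {R : realType} {Z W : normedModType R}.
Variables (f : Z -> W) (K : R).
Hypothesis f_cont : continuous f.
Hypothesis f_bnd : forall z, `|z| = 1 -> `|f z| <= K.

Definition radial (z : Z) : W := `|z| *: f (`|z|^-1 *: z).

Lemma normalize_norm (z : Z) : z != 0 -> `| `|z|^-1 *: z | = 1.
Proof. by move=> z0; rewrite normrZ normfV normr_id mulVf ?normr_eq0. Qed.

Lemma radial_norm (z : Z) : `|radial z| <= K * `|z|.
Proof.
rewrite /radial normrZ normr_id mulrC.
have [->|z0] := eqVneq z 0; first by rewrite normr0 !mulr0.
by rewrite ler_wpM2r// f_bnd// normalize_norm.
Qed.

Lemma radial_homogeneous : positively_homogeneous radial.
Proof.
move=> l z; rewrite le_eqVlt => /predU1P[<-|l0].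
  by rewrite /radial !scale0r normr0 scale0r.
rewrite /radial normrZ gtr0_norm// [RHS]scalerA; congr (_ *: f _).
by rewrite scalerA invfM mulrAC mulVf ?gt_eqF// mul1r.
Qed.

(** At 0, where the direction is undefined, continuity comes from the bound
[radial_norm]. *)
Lemma radial_continuous : continuous radial.
Proof.
move=> z; have [->|z0] := eqVneq z 0.
  rewrite /continuous_at {2}/radial normr0 scale0r.
  apply: norm_cvg0; apply: (@squeeze_cvgr _ _ _ _ (fun=> 0) (fun z => K * `|z|)).
  - by apply: nearW => y; rewrite normr_ge0 radial_norm.
  - exact: cvg_cst.
  - rewrite -[X in _ --> X](mulr0 K) -(normr0 Z); apply: cvgM; first exact: cvg_cst.
    by apply: cvg_norm; exact: cvg_id.
apply: cvgZ; first by apply: cvg_norm; exact: cvg_id.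
apply: (@continuous_comp _ _ _ (fun z : Z => `|z|^-1 *: z) f); last exact: f_cont.
apply: cvgZ; last exact: cvg_id.
by apply: cvgV; [rewrite normr_eq0|by apply: cvg_norm; exact: cvg_id].
Qed.

End RadialExtension.

(** * The open mapping theorem for closed cones *)

Section BallPreimage.
Context {R : realType} {W V : normedModType R} (f : {linear W -> V}).
Variables (x : V) (r : R).

Lemma closed_ball_preimage :
  continuous f -> closed [set w | `|x - f w| <= r].
Proof.
move=> cf; apply: (@closed_comp _ _ (fun w => `|x - f w|) [set s | s <= r]).
  move=> w _; apply: cvg_norm; apply: cvgB; [exact: cvg_cst|exact: cf].
exact: closed_le.
Qed.

Lemma convex_ball_preimage :
  convex_set ([set w | `|x - f w| <= r] : set (convex_lmodType W)).
Proof.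
apply/convex_setW => u v; rewrite !inE/= => ur vr k k0 k1; rewrite inE/=.
set l := k%:num in k0 k1 *.
have -> : x - f (l *: u + (1 - l) *: v) =
    l *: (x - f u) + (1 - l) *: (x - f v).
  rewrite linearD !linearZ/= !scalerBr addrACA -scalerDl addrC addrCA.
  by rewrite subrr addr0 scale1r opprD addrC.
rewrite (le_trans (ler_normD _ _))// !normrZ.
rewrite gtr0_norm// gtr0_norm ?subr_gt0//.
have -> : r = l * r + (1 - l) * r by ring.
by rewrite lerD// ler_wpM2l// ?subr_ge0 ltW.
Qed.

End BallPreimage.

Section ConeOpenMapping.
Context {R : realType} {W Z : completeNormedModType R}.
Variables (G : set W) (T : {linear W -> Z}).
Hypotheses (G_cone : is_cone G) (G_closed : closed G) (T_cont : continuous T).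

Lemma cone_convex : convex_set (G : set (convex_lmodType W)).
Proof.
case: G_cone => _ GD GZ; apply/convex_setW => x y; rewrite !inE => Gx Gy k k0 k1.
by rewrite inE; apply: GD; apply: GZ => //; rewrite -[leRHS]/(1 - k%:num) subr_ge0 ltW.
Qed.

Hypothesis G_onto : forall z, exists2 w, G w & T w = z.

(** The two errors of [1/4] come from the radius of the balls of the local mean
and from the accuracy of [cone_almost_open]; on the unit sphere they add up to
the relative error [1/2]. The factor 2 in the norm bound leaves room for centres
slightly outside the sphere. *)
Lemma continuous_approximate_section : exists2 K : R, 0 < K &
  exists h : Z -> W, [/\ continuous h, positively_homogeneous h &
    forall z, [/\ G (h z), `|h z| <= K * `|z| &
      `|z - T (h z)| <= 2^-1 * `|z|] ].
Proof.
have [K K0 openK] := cone_almost_open G_cone G_onto.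
have q0 : 0 < 4^-1 :> R by rewrite invr_gt0.
have [a aP] := choice (fun z => openK z _ q0).
have [h0 ch0 h0P] : exists2 h : Z -> W, continuous h &
    forall x (A : set W), closed A ->
      convex_set (A : set (convex_lmodType W)) ->
      (forall i, `|x - i| < 4^-1 -> A (a i)) -> A (h x).
  apply: continuous_local_mean => // r; exists (K * r) => i ir.
  by have [_ ai _] := aP i; rewrite (le_trans ai)// ler_pM2l.
have h0G z : G (h0 z).
  by apply: h0P => //; [exact: cone_convex|move=> i _; have [] := aP i].
have h0K z : `|z| = 1 -> `|h0 z| <= K * 2.
  move=> z1; rewrite -normrN -sub0r.
  have cid : continuous (idfun : {linear W -> W}) by move=> w; exact: cvg_id.
  apply: (h0P z [set w | `|0 - w| <= K * 2]).
  - exact: (closed_ball_preimage cid).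
  - exact: (convex_ball_preimage (f := idfun)).
  move=> i zi.
  rewrite /= sub0r normrN; have [_ ai _] := aP i.
  rewrite (le_trans ai)// ler_pM2l// -[i](subrK z).
  rewrite (le_trans (ler_normD _ _))// z1 distrC -lerBrDr.
  by rewrite (le_trans (ltW zi))//; lra.
have h0T z : `|z - T (h0 z)| <= 2^-1.
  apply: (h0P z [set w | `|z - T w| <= 2^-1]).
  - exact: (closed_ball_preimage T_cont).
  - exact: (convex_ball_preimage (f := T)).
  move=> i zi; have [_ _ iT] := aP i.
  by rewrite /= (le_trans (ler_distD i _ _))// (le_trans (lerD (ltW zi) iT))//; lra.
exists (K * 2); first by rewrite mulr_gt0.
exists (radial h0); split.
- exact: radial_continuous ch0 h0K.
- exact: radial_homogeneous.
move=> z; split; [| exact: radial_norm |].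
  by case: G_cone => _ _; apply.
have [->|z0] := eqVneq z 0.
  by rewrite /radial normr0 scale0r linear0 subrr normr0 mulr0.
have -> : z - T (radial h0 z) =
    `|z| *: (`|z|^-1 *: z - T (h0 (`|z|^-1 *: z))).
  by rewrite linearZ scalerBr scalerA divff ?scale1r// normr_eq0.
by rewrite normrZ normr_id mulrC ler_wpM2r.
Qed.

(** For [G = setT] this is the Bartle-Graves theorem, with homogeneity for
nonnegative scalars only. *)
Theorem cone_continuous_section : exists2 K : R, 0 < K &
  exists s : Z -> W, [/\ continuous s, positively_homogeneous s &
    forall z, [/\ G (s z), T (s z) = z & `|s z| <= K * `|z|] ].
Proof.
have [K K0 [h [ch hh hP]]] := continuous_approximate_section.
exists (2 * K); first by rewrite mulr_gt0.
exact: (section_of_approximate_section G_cone G_closed T_cont (ltW K0) ch hh hP).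
Qed.

End ConeOpenMapping.

(** * Selections of intersections of translated cones *)

Section ProductComplete.
Context {R : realType} {U V : completeNormedModType R}.

(* Declaring the point again makes the joins of the pointed and the topological
   structures available on the product. *)
HB.instance Definition _ := Pointed.on (U * V)%type.

Lemma prod_cauchy_cvg (F : set_system (U * V)) :
  ProperFilter F -> cauchy F -> cvg F.
Proof.
move=> FF /cauchyP cF.
have cU : cvg (fst @ F).
  apply: cauchy_cvg; apply/cauchy_exP => e e0; have [p h] := cF e e0.
  by exists p.1; rewrite /= nbhs_simpl; apply: filterS h => q [].
have cV : cvg (snd @ F).
  apply: cauchy_cvg; apply/cauchy_exP => e e0; have [p h] := cF e e0.
  by exists p.2; rewrite /= nbhs_simpl; apply: filterS h => q [].
apply/cvg_ex; exists (lim (fst @ F), lim (snd @ F)).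
apply: cvg_trans (cvg_pair cU cV).
rewrite [X in _ `=>` X @ F](_ : _ = id)//.
by apply/funext => -[].
Qed.

HB.instance Definition _ :=
  Uniform_isComplete.Build (U * V)%type prod_cauchy_cvg.

End ProductComplete.

Section Translates.
Context {R : realType} {X : completeNormedModType R} {Omega : Type}.
Variables (C : Omega -> set X) (Z : completeNormedModType R).
Variable ev : Omega -> Z -> X.
Hypotheses (C_cone : forall w, is_cone (C w)) (C_closed : forall w, closed (C w)).
Hypotheses (ev_linear : forall w, linear (ev w))
  (ev_norm : forall w xi, `|ev w xi| <= `|xi|).

Let bigcapP xi y : bigcap_translates C (ev^~ xi) y <->
  forall w, C w (y - ev w xi).
Proof.
split=> [h w|h w _]; last by exists (y - ev w xi); [exact: h|rewrite addrC subrK].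
by have [c Cc <-] := h w I; rewrite addrAC subrr add0r.
Qed.

(** [cone_continuous_section] is applied to the first projection of [Z * X],
restricted to the cone of pairs [(xi, y)] with [y] in the intersection for
[xi]; the second component of the section is the selection. *)
Lemma bigcap_translates_continuous_selection :
  (forall xi, bigcap_translates C (ev^~ xi) !=set0) ->
  exists2 alpha : R, 0 < alpha & exists upsilon : Z -> X,
    [/\ continuous upsilon, positively_homogeneous upsilon
      & forall xi, bigcap_translates C (ev^~ xi) (upsilon xi)
        /\ `|upsilon xi| <= alpha * `|xi|].
Proof.
move=> ne.
have evD w xi eta : ev w (xi + eta) = ev w xi + ev w eta.
  by have := ev_linear w 1 xi eta; rewrite !scale1r.
have ev0 w : ev w 0 = 0.
  by apply: (@addrI _ (ev w 0)); rewrite -evD !addr0.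
have evZ w l xi : ev w (l *: xi) = l *: ev w xi.
  by have := ev_linear w l xi 0; rewrite !addr0 ev0 addr0.
have ev_cont w : continuous (ev w).
  move=> xi; apply/cvgrPdist_lt => e e0; near=> eta.
  apply: (@le_lt_trans _ _ `|xi - eta|); last by near: eta; exact: cvgr_dist_lt.
  rewrite (_ : ev w xi - ev w eta = ev w (xi - eta))//.
  by rewrite evD -[- eta]scaleN1r evZ scaleN1r.
pose G : set (Z * X) := [set p | forall w, C w (p.2 - ev w p.1)].
have G_cone : is_cone G.
  split.
  - exists (0, 0) => w /=; rewrite ev0 subrr.
    by have [[c Cc] _ CZ] := C_cone w; rewrite -(scale0r c); exact: CZ.
  - move=> p q Gp Gq w /=; rewrite evD opprD addrACA.
    by have [_ CD _] := C_cone w; exact: CD.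
  - move=> l p l0 Gp w /=; rewrite evZ -scalerBr.
    by have [_ _ CZ] := C_cone w; exact: CZ.
have G_closed : closed G.
  rewrite (_ : G = \bigcap_w [set p | C w (p.2 - ev w p.1)]); last first.
    by apply/seteqP; split=> [p Gp w _|p Gp w]; [exact: Gp|exact: (Gp w)].
  apply: closed_bigI => w _.
  apply: (@closed_comp _ _ (fun p : Z * X => p.2 - ev w p.1) (C w)) => //.
  move=> p _; apply: cvgB; first exact: cvg_snd.
  by apply: (@continuous_comp _ _ _ fst (ev w)); [exact: cvg_fst|exact: ev_cont].
have fst_cont : continuous (fst : {linear (Z * X)%type -> Z}).
  by move=> p; exact: cvg_fst.
have G_onto xi : exists2 p, G p & (fst : {linear (Z * X)%type -> Z}) p = xi.
  by have [y /bigcapP Gy] := ne xi; exists (xi, y).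
have [K K0 [s [cs hs sP]]] := cone_continuous_section G_cone G_closed fst_cont G_onto.
exists K => //; exists (snd \o s); split.
- move=> xi; apply: continuous_comp; [exact: cs|exact: cvg_snd].
- by move=> l xi l0 /=; rewrite hs.
move=> xi; have [Gs sxi sK] := sP xi; split.
  by apply/bigcapP => w; have := Gs w; rewrite /= in sxi *; rewrite sxi.
by apply: le_trans sK; rewrite prod_normE /= le_max lexx orbT.
Unshelve. all: by end_near. Qed.

Lemma bigcap_translates_selection_tfae :
  [<-> forall xi, bigcap_translates C (ev^~ xi) !=set0;
       exists2 alpha : R, 0 < alpha & forall xi,
         exists2 y : X, bigcap_translates C (ev^~ xi) y & `|y| <= alpha * `|xi|;
       exists2 alpha : R, 0 < alpha & exists upsilon : Z -> X,
         [/\ continuous upsilon, positively_homogeneous upsilon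
           & forall xi, bigcap_translates C (ev^~ xi) (upsilon xi)
             /\ `|upsilon xi| <= alpha * `|xi|] ].
Proof.
tfae.
- move=> /bigcap_translates_continuous_selection[alpha a0 [upsilon [_ _ uP]]].
  by exists alpha => // xi; exists (upsilon xi); have [] := uP xi.
- move=> [alpha a0 bnd]; apply: bigcap_translates_continuous_selection => xi.
  by have [y yP _] := bnd xi; exists y.
- by move=> [alpha a0 [upsilon [_ _ uP]]] xi; exists (upsilon xi); have [] := uP xi.
Qed.

End Translates.

Theorem corollary5p5 (R : realType) (X : completeNormedModType R)
    (Omega : Type) (C : Omega -> set X)
    (C_cone : forall w, is_cone (C w)) (C_closed : forall w, closed (C w)) :
  [<-> forall xi : cspace Omega X, bigcap_translates C xi !=set0;
       exists2 alpha : R, 0 < alpha & forall xi : cspace Omega X,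
         exists2 y : X, bigcap_translates C xi y & `|y| <= alpha * `|xi|;
       exists2 alpha : R, 0 < alpha & exists upsilon : cspace Omega X -> X,
         [/\ continuous upsilon, positively_homogeneous upsilon
           & forall xi : cspace Omega X, bigcap_translates C xi (upsilon xi)
             /\ `|upsilon xi| <= alpha * `|xi|] ]
  /\
  [<-> forall xi : linfty Omega X, bigcap_translates C xi !=set0;
       exists2 alpha : R, 0 < alpha & forall xi : linfty Omega X,
         exists2 y : X, bigcap_translates C xi y & `|y| <= alpha * `|xi|;
       exists2 alpha : R, 0 < alpha & exists upsilon : linfty Omega X -> X,
         [/\ continuous upsilon, positively_homogeneous upsilon
           & forall xi : linfty Omega X, bigcap_translates C xi (upsilon xi)
             /\ `|upsilon xi| <= alpha * `|xi|] ].
Proof.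
split.
- apply: (bigcap_translates_selection_tfae (ev := fun w (xi : cspace Omega X) => xi w))
    => // w xi.
  exact: linfty_norm_ub (cspace_val xi) w.
- apply: (bigcap_translates_selection_tfae (ev := fun w (xi : linfty Omega X) => xi w))
    => // w xi.
  exact: linfty_norm_ub.
Qed.
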